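(* Let $n\ge 2$ be an integer, let $I\subseteq\mathbb{R}$ be an open interval, let $f:I\to\mathbb{R}$ be differentiable with $f'$ injective on $I$, and let $g=\mathcal{L}\{f\}:f'(I)\to\mathbb{R}$ be its Legendre transformation. Let $x_0\in I$ be such that $f$ is $n$ times differentiable at $x_0$ and $f''(x_0)\neq 0$, and put $m_0=f'(x_0)$. Then $g$ is $n$ times differentiable at $m_0$, and its derivatives at $m_0$ up to order $n$ (hence the coefficients of its degree-$n$ Taylor polynomial about $m_0$) are given by $$g(m_0)=x_0f'(x_0)-f(x_0),\qquad g'(m_0)=x_0,\qquad g''(m_0)=\frac{1}{f''(x_0)},$$ and, for every integer $k$ with $2\le k\le n-1$, by the recursion formula $$g^{(k+1)}(f'(x))=\frac{1}{f''(x)}\,\frac{d}{dx}\Big[g^{(k)}(f'(x))\Big]\quad\text{at } x=x_0 .$$ In particular, for each $2\le k\le n$, $g^{(k)}(m_0)$ is a function of the derivatives of $f$ at $x_0$ of order at most $k$, and, whenever the order of the derivative of $g$ is at most $n$, $$g'''(m_0)=-\frac{f'''(x_0)}{(f''(x_0))^3},$$ $$g^{(4)}(m_0)=\frac{3(f'''(x_0))^2-f''(x_0)f^{(4)}(x_0)}{(f''(x_0))^5},$$ $$g^{(5)}(m_0)=\frac{10f''(x_0)f'''(x_0)f^{(4)}(x_0)-15(f'''(x_0))^3-(f''(x_0))^2f^{(5)}(x_0)}{(f''(x_0))^7}.$$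
   Context: For a differentiable function $f$ on an open interval $I$ whose derivative $f'$ is injective, the Legendre transformation $\mathcal{L}\{f\}=g$ is the function on $f'(I)$ such that the tangent line to $y=f(x)$ of slope $m$ is $y=mx-g(m)$; equivalently, $g(f'(x))=xf'(x)-f(x)$ for all $x\in I$, that is, $g(m)=m\,(f')^{-1}(m)-f\big((f')^{-1}(m)\big)$ for $m\in f'(I)$. A function is $n$ times differentiable at a point if its derivatives of order up to $n-1$ exist in a neighborhood of the point and its derivative of order $n$ exists at the point. *)

(* Defs.v *)
(* Classical analysis over Stdlib's R, with Coquelicot's total derivative
   operators [Derive] and [Derive_n]. *)
From Stdlib Require Import Reals.
From Coquelicot Require Import Coquelicot.
Local Open Scope R_scope.

Definition in_Rbar_interval (a b : Rbar) (x : R) : Prop :=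
  Rbar_lt a x /\ Rbar_lt x b.

(* [ex_derive_n f k] alone says that the total function [Derive_n f (k - 1)] is
   differentiable; it means existence of the k-th derivative only because the
   lower orders are required on a whole neighbourhood. *)
Definition n_times_differentiable_at (n : nat) (f : R -> R) (x : R) : Prop :=
  locally x (fun y => forall k : nat, (k < n)%nat -> ex_derive_n f k y) /\
  ex_derive_n f n x.

(* The values of [g] are prescribed exactly on f'(I), for I = (a, b), and are
   unconstrained elsewhere: [g] is any extension to R of the Legendre
   transform of [f] restricted to I. *)
Definition is_legendre (a b : Rbar) (f g : R -> R) : Prop :=
  forall x : R, in_Rbar_interval a b x ->
    g (Derive f x) = x * Derive f x - f x.

(* Main.v *)
Require Import Defs.
From Stdlib Require Import Reals List Lra Lia.
From Coquelicot Require Import Coquelicot.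
Local Open Scope R_scope.

(** By Darboux's theorem a derivative has the intermediate value property, so
    an injective derivative [f'] on an interval is strictly monotone
    ([Derive_between]), and it carries neighbourhoods of a point to
    neighbourhoods of its image ([Derive_locally_onto]).  The latter is openness
    of [f'] and continuity of its inverse at once, and it is how every property
    of [g] near [f'(x)] is reduced to a property of [f] near [x].

    The first derivative of [g] at [f'(x)] is [x] ([is_derive_legendre]):
    by the mean value theorem the error of the linear approximation is
    [(f'(y) - f'(c)) * (y - x)] with [c] between [x] and [y], and monotonicity
    of [f'] bounds the first factor by [|f'(y) - f'(x)|].  Hence [g'] is
    the inverse function of [f'], and
    [g''(f'(x)) = 1 / f''(x)] wherever [f''(x)] exists and is not zero
    ([is_derive_inverse_slope]).

    The higher orders follow by induction ([legendre_derivatives]).  If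
    [g^(k)(f'(y)) = G_k(y)] for [y] near [x], then [g^(k) = G_k o g'] near
    [f'(x)], and the chain rule gives [g^(k+1)(f'(x)) = G_k'(x) / f''(x)].  As
    [G_2 = 1 / f''], each [G_k] is a polynomial in [1 / f''] and derivatives of
    [f] of order at most [k].  These polynomials are kept as syntax
    ([legendre_expr]), which makes them independent of [f] and allows them to be
    differentiated formally; their values are the functions [Phi k], and the
    closed formulas for orders 3, 4 and 5 are instances of them. *)

(** * Derivatives have the intermediate value property *)

Lemma is_derive_Rabs (f : R -> R) (x l : R) :
  is_derive f x l <->
  forall eps : posreal, exists delta : posreal, forall y : R,
    Rabs (y - x) < delta ->
    Rabs (f y - f x - l * (y - x)) <= eps * Rabs (y - x).
Proof.
  split.
  - intros [_ H] eps.
    destruct (H x (fun P HP => HP) eps) as [delta Hd].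
    exists delta; intros y Hy.
    specialize (Hd y Hy).
    unfold norm, minus, plus, opp, scal in Hd; simpl in Hd.
    unfold abs, mult in Hd; simpl in Hd.
    replace (f y - f x - l * (y - x))
      with (f y + - f x + - ((y + - x) * l)) by ring.
    exact Hd.
  - intros H. split.
    { apply is_linear_scal_l. }
    intros x' Hx' eps.
    rewrite <- (is_filter_lim_locally_unique x x' Hx').
    destruct (H eps) as [delta Hd].
    exists delta; intros y Hy.
    specialize (Hd y Hy).
    unfold norm, minus, plus, opp, scal; simpl.
    unfold abs, mult; simpl.
    replace (f y + - f x + - ((y + - x) * l))
      with (f y - f x - l * (y - x)) by ring.
    exact Hd.
Qed.

Lemma descent_direction (h : R -> R) (x d v : R) :
  is_derive h x d -> d * v < 0 ->
  exists r : posreal, forall s, 0 < s < r -> h (x + s * v) < h x.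
Proof.
  intros Hh Hdv.
  assert (Hv : 0 < Rabs v) by (apply Rabs_pos_lt; nra).
  assert (He : 0 < - (d * v) / (2 * Rabs v)) by (apply Rdiv_lt_0_compat; lra).
  destruct (proj1 (is_derive_Rabs h x d) Hh (mkposreal _ He)) as [r Hr].
  assert (Hrv : 0 < r / Rabs v) by (apply Rdiv_lt_0_compat; [apply cond_pos|lra]).
  exists (mkposreal _ Hrv); simpl; intros s Hs.
  specialize (Hr (x + s * v)); simpl in Hr.
  replace (x + s * v - x) with (s * v) in Hr by ring.
  rewrite Rabs_mult, (Rabs_pos_eq s) in Hr by lra.
  assert (Hsv : s * Rabs v < r).
  { apply Rlt_div_r; lra. }
  specialize (Hr Hsv). apply Rabs_le_between in Hr.
  replace (- (d * v) / (2 * Rabs v) * (s * Rabs v)) with (- (d * v) * s / 2) in Hr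
    by (field; lra).
  nra.
Qed.

(** The function [t |-> f t - m * t] has negative derivative at [a] and positive
    derivative at [b], so its minimum over [[a, b]] is interior; there its
    derivative vanishes. *)
Lemma Darboux_increasing (f : R -> R) (a b m : R) :
  a < b -> (forall x, a <= x <= b -> ex_derive f x) ->
  Derive f a < m < Derive f b -> exists c, a < c < b /\ Derive f c = m.
Proof.
  intros Hab Hf Hm.
  set (h := fun x => f x - m * x).
  assert (Hh : forall x, a <= x <= b -> is_derive h x (Derive f x - m)).
  { intros x Hx. unfold h. generalize (Derive_correct f x (Hf x Hx)); intros H.
    auto_derive; [apply (Hf x Hx)|]. simpl. change (fun x0 => f x0) with f. ring. }
  destruct (continuity_ab_min h a b) as [c [Hmin Hc]]; [lra| |].
  { intros x Hx. apply continuity_pt_filterlim.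
    apply (@ex_derive_continuous R_AbsRing R_NormedModule).
    eexists; apply (Hh x Hx). }
  assert (Hstep : forall r : posreal, exists s, 0 < s < r /\ s < b - a).
  { intros r. pose proof (cond_pos r). exists (Rmin (b - a) r / 2).
    unfold Rmin; destruct Rle_dec; lra. }
  assert (Hca : a < c).
  { destruct (Req_dec c a) as [->|]; [|lra]. exfalso.
    destruct (descent_direction h a _ 1 (Hh a Hc) ltac:(lra)) as [r Hr].
    destruct (Hstep r) as (s & Hs & Hsb). specialize (Hr s Hs).
    specialize (Hmin (a + s * 1) ltac:(lra)). lra. }
  assert (Hcb : c < b).
  { destruct (Req_dec c b) as [->|]; [|lra]. exfalso.
    destruct (descent_direction h b _ (-1) (Hh b Hc) ltac:(lra)) as [r Hr].
    destruct (Hstep r) as (s & Hs & Hsb). specialize (Hr s Hs).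
    specialize (Hmin (b + s * -1) ltac:(lra)). lra. }
  exists c; split; [lra|].
  assert (pr : derivable_pt h c).
  { apply ex_derive_Reals_0. eexists; apply (Hh c Hc). }
  assert (H0 : derive_pt h c pr = 0).
  { apply (deriv_minimum h a b c pr Hca Hcb).
    intros x Hx1 Hx2. apply Hmin; lra. }
  rewrite Derive_Reals, (is_derive_unique _ _ _ (Hh c Hc)) in H0. lra.
Qed.

Lemma Darboux (f : R -> R) (a b m : R) :
  a < b -> (forall x, a <= x <= b -> ex_derive f x) ->
  (Derive f a < m < Derive f b \/ Derive f b < m < Derive f a) ->
  exists c, a < c < b /\ Derive f c = m.
Proof.
  intros Hab Hf [Hm|Hm].
  - now apply Darboux_increasing.
  - destruct (Darboux_increasing (fun x => - f x) a b (- m)) as [c [Hc Hcm]].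
    + exact Hab.
    + intros x Hx. now apply (@ex_derive_opp R_AbsRing R_NormedModule), Hf.
    + rewrite !Derive_opp; lra.
    + exists c; split; [exact Hc|]. rewrite Derive_opp in Hcm. lra.
Qed.

Lemma in_Rbar_interval_convex (a b : Rbar) (x y t : R) :
  in_Rbar_interval a b x -> in_Rbar_interval a b y -> x <= t <= y ->
  in_Rbar_interval a b t.
Proof.
  intros [Hx _] [_ Hy] Ht. split.
  - apply (Rbar_lt_le_trans _ x); [exact Hx|simpl; lra].
  - apply (Rbar_le_lt_trans _ y); [simpl; lra|exact Hy].
Qed.

Lemma in_Rbar_interval_locally (a b : Rbar) (x : R) :
  in_Rbar_interval a b x -> locally x (in_Rbar_interval a b).
Proof.
  intros [Hx Hy]. apply filter_and.
  - now apply open_Rbar_gt.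
  - now apply open_Rbar_lt.
Qed.

(** * First and second derivative of the Legendre transform *)

Section Legendre.

Variables (a b : Rbar) (f g : R -> R).
Let I := in_Rbar_interval a b.
Hypothesis f_diff : forall x, I x -> ex_derive f x.
Hypothesis f'_inj : forall x y, I x -> I y -> Derive f x = Derive f y -> x = y.
Hypothesis g_legendre : is_legendre a b f g.

(** Among three distinct values of [f'], one lies strictly between the other two.
    Were it that of an endpoint, [f'] would take it again, by Darboux, between
    the two other points, against injectivity. *)
Lemma Derive_between (x y z : R) :
  I x -> I z -> x < y < z ->
  Derive f x < Derive f y < Derive f z \/ Derive f z < Derive f y < Derive f x.
Proof.
  intros Hx Hz Hxyz.
  assert (HI : forall t, x <= t <= z -> I t).
  { intros t Ht. now apply (in_Rbar_interval_convex a b x z). }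
  assert (Hneq : forall s t, x <= s <= z -> x <= t <= z -> s <> t ->
            Derive f s <> Derive f t).
  { intros s t Hs Ht Hst E. apply Hst, f'_inj; auto. }
  pose proof (Hneq x y ltac:(lra) ltac:(lra) ltac:(lra)).
  pose proof (Hneq y z ltac:(lra) ltac:(lra) ltac:(lra)).
  pose proof (Hneq x z ltac:(lra) ltac:(lra) ltac:(lra)).
  assert (Hz' : ~ (Derive f x < Derive f z < Derive f y \/
                   Derive f y < Derive f z < Derive f x)).
  { intros Hm. destruct (Darboux f x y (Derive f z)) as [c [Hc E]]; [lra| |exact Hm|].
    - intros t Ht. apply f_diff, HI; lra.
    - apply (Hneq c z); lra. }
  assert (Hx' : ~ (Derive f y < Derive f x < Derive f z \/
                   Derive f z < Derive f x < Derive f y)).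
  { intros Hm. destruct (Darboux f y z (Derive f x)) as [c [Hc E]]; [lra| |exact Hm|].
    - intros t Ht. apply f_diff, HI; lra.
    - apply (Hneq c x); lra. }
  lra.
Qed.

(** The points [y] can be taken in any prescribed neighbourhood of [x], so this
    says both that [f'] is open at [x] and that its inverse is continuous at
    [f'(x)]. *)
Lemma Derive_locally_onto (x : R) (P : R -> Prop) :
  I x -> locally x P ->
  locally (Derive f x) (fun m => exists y, I y /\ P y /\ Derive f y = m).
Proof.
  intros Hx HP.
  destruct (filter_and _ _ HP (in_Rbar_interval_locally a b x Hx)) as [e He].
  assert (HB : forall y, Rabs (y - x) < e -> P y /\ I y) by (intros y; apply He).
  pose proof (cond_pos e) as e0.
  assert (Hu : Rabs (x - e / 2 - x) < e) by (apply Rabs_def1; lra).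
  assert (Hv : Rabs (x + e / 2 - x) < e) by (apply Rabs_def1; lra).
  apply HB, proj2 in Hu. apply HB, proj2 in Hv.
  (* [f'(x)] lies strictly between [f'(u)] and [f'(v)], so by Darboux all nearby
     slopes are attained between [u] and [v]. *)
  set (u := x - e / 2) in *. set (v := x + e / 2) in *.
  assert (Huv : u < x < v) by (unfold u, v; lra).
  assert (Hd : exists d : posreal, forall m, Rabs (m - Derive f x) < d ->
     Derive f u < m < Derive f v \/ Derive f v < m < Derive f u).
  { pose proof (Derive_between u x v Hu Hv Huv) as Hbt.
    assert (Hp : 0 < Rmin (Rabs (Derive f x - Derive f u))
                          (Rabs (Derive f v - Derive f x))).
    { apply Rmin_pos; apply Rabs_pos_lt; lra. }
    exists (mkposreal _ Hp); simpl; intros m Hm.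
    pose proof (Rlt_le_trans _ _ _ Hm (Rmin_l _ _)) as H1.
    pose proof (Rlt_le_trans _ _ _ Hm (Rmin_r _ _)) as H2.
    revert H1 H2. unfold Rabs; repeat destruct Rcase_abs; lra. }
  destruct Hd as [d Hd]. exists d; intros m Hm.
  destruct (Darboux f u v m) as [y [Hy E]]; [lra| |apply Hd, Hm|].
  { intros t Ht. apply f_diff. now apply (in_Rbar_interval_convex a b u v). }
  destruct (HB y) as [HPy HIy].
  { apply Rabs_def1; unfold u, v in *; lra. }
  now exists y.
Qed.

(** The mean value theorem turns the remainder into
    [(f'(y) - f'(c)) * (y - x)], whose first factor is at most
    [|f'(y) - f'(x)|] by monotonicity and whose second factor is small because
    the inverse of [f'] is continuous. *)
Lemma is_derive_legendre (x : R) : I x -> is_derive g (Derive f x) x.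
Proof.
  intros Hx. apply is_derive_Rabs; intros eps.
  destruct (Derive_locally_onto x (fun y => Rabs (y - x) < eps) Hx) as [d Hd].
  { exists eps; intros y Hy; exact Hy. }
  exists d; intros m Hm. destruct (Hd m Hm) as (y & Hy & Hyx & <-).
  rewrite !g_legendre by assumption.
  assert (Hc : exists c, f y - f x = Derive f c * (y - x) /\
             Rabs (Derive f y - Derive f c) <= Rabs (Derive f y - Derive f x)).
  { destruct (MVT_gen f x y (Derive f)) as [c [Hc E]].
    - intros t Ht. apply Derive_correct, f_diff.
      unfold Rmin, Rmax in Ht; destruct Rle_dec;
        [apply (in_Rbar_interval_convex a b x y)
        |apply (in_Rbar_interval_convex a b y x)]; auto; lra.
    - intros t Ht. apply continuity_pt_filterlim.
      apply (@ex_derive_continuous R_AbsRing R_NormedModule), f_diff.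
      unfold Rmin, Rmax in Ht; destruct Rle_dec;
        [apply (in_Rbar_interval_convex a b x y)
        |apply (in_Rbar_interval_convex a b y x)]; auto; lra.
    - exists c; split; [exact E|].
      destruct (Req_dec c x) as [->|Hcx]; [lra|].
      destruct (Req_dec c y) as [->|Hcy].
      { rewrite Rminus_diag, Rabs_R0. apply Rabs_pos. }
      assert (Hb : Derive f x < Derive f c < Derive f y \/
                   Derive f y < Derive f c < Derive f x).
      { unfold Rmin, Rmax in Hc; destruct Rle_dec.
        - destruct (Derive_between x c y); auto; lra.
        - destruct (Derive_between y c x); auto; lra. }
      unfold Rabs; repeat destruct Rcase_abs; lra. }
  destruct Hc as (c & E & Hc).
  replace (y * Derive f y - f y - (x * Derive f x - f x)
           - x * (Derive f y - Derive f x))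
    with ((Derive f y - Derive f c) * (y - x)) by nra.
  rewrite Rabs_mult, (Rmult_comm eps).
  apply Rmult_le_compat; auto using Rabs_pos, Rlt_le.
Qed.

(** The total function [Derive g] serves as the inverse of [Derive f]: properties
    of the inverse are stated for it. *)
Lemma Derive_legendre (x : R) : I x -> Derive g (Derive f x) = x.
Proof. intros Hx. now apply is_derive_unique, is_derive_legendre. Qed.

(** With [M] the increment of [f'], [h] that of [x] and [d = f''(x)], the
    remainder of the inverse is [- (M - d * h) / d].  Since [|M - d * h|] is at
    most [|d| / 2 * |h|], the increment [h] is at most [2 * |M| / |d|], so a bound
    on [M - d * h] relative to [h] becomes one relative to [M]. *)
Lemma is_derive_inverse_slope (x : R) :
  I x -> ex_derive (Derive f) x -> Derive_n f 2 x <> 0 ->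
  is_derive (Derive g) (Derive f x) (/ Derive_n f 2 x).
Proof.
  intros Hx Hf Hd.
  pose proof (Derive_correct _ _ Hf) as Hf2.
  change (Derive (Derive f) x) with (Derive_n f 2 x) in Hf2.
  set (d := Derive_n f 2 x) in *.
  assert (Had : 0 < Rabs d) by now apply Rabs_pos_lt.
  apply is_derive_Rabs; intros eps. pose proof (cond_pos eps) as e0.
  assert (He : 0 < Rmin (Rabs d / 2) (eps * (Rabs d * Rabs d) / 2)).
  { apply Rmin_pos; [lra|]. assert (0 < Rabs d * Rabs d) by nra. nra. }
  destruct (proj1 (is_derive_Rabs _ _ _) Hf2 (mkposreal _ He)) as [r Hr].
  destruct (Derive_locally_onto x (fun y => Rabs (y - x) < r) Hx) as [s Hs].
  { exists r; intros y Hy; exact Hy. }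
  exists s; intros m Hm. destruct (Hs m Hm) as (y & Hy & Hyx & <-).
  rewrite !Derive_legendre by assumption.
  specialize (Hr y Hyx); simpl in Hr.
  set (M := Derive f y - Derive f x) in *. set (h := y - x) in *.
  pose proof (Rabs_pos h) as Hh.
  assert (H1 : Rabs (M - d * h) <= Rabs d / 2 * Rabs h).
  { eapply Rle_trans; [exact Hr|]. apply Rmult_le_compat_r; [lra|apply Rmin_l]. }
  assert (H2 : Rabs (M - d * h) <= eps * (Rabs d * Rabs d) / 2 * Rabs h).
  { eapply Rle_trans; [exact Hr|]. apply Rmult_le_compat_r; [lra|apply Rmin_r]. }
  assert (H3 : Rabs d * Rabs h <= Rabs M + Rabs (M - d * h)).
  { rewrite <- Rabs_mult. replace (d * h) with (M - (M - d * h)) by ring.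
    eapply Rle_trans; [apply Rabs_triang|]. rewrite Rabs_Ropp.
    replace (M - (M - (M - d * h))) with (M - d * h) by ring. lra. }
  assert (H4 : Rabs d * Rabs h <= 2 * Rabs M) by nra.
  replace (h - / d * M) with (- / d * (M - d * h)) by (field; exact Hd).
  rewrite Rabs_mult, Rabs_Ropp, Rabs_inv.
  apply (Rmult_le_reg_l (Rabs d)); [exact Had|].
  rewrite <- Rmult_assoc, Rinv_r, Rmult_1_l by lra.
  eapply Rle_trans; [exact H2|].
  replace (eps * (Rabs d * Rabs d) / 2 * Rabs h)
    with (eps * Rabs d / 2 * (Rabs d * Rabs h)) by field.
  replace (Rabs d * (eps * Rabs M)) with (eps * Rabs d / 2 * (2 * Rabs M)) by field.
  apply Rmult_le_compat_l; [nra|exact H4].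
Qed.

End Legendre.

(** * Differential polynomials in the jet of a function *)

(** Polynomials in the derivatives of a function and in [1 / f'']: [Jet j] stands
    for [f^(j)] and [Inv2] for [1 / f'']. *)
Inductive jet_expr : Type :=
| Jet (j : nat)
| Inv2
| Opp (e : jet_expr)
| Add (e1 e2 : jet_expr)
| Mul (e1 e2 : jet_expr).

Fixpoint eval (env : nat -> R) (e : jet_expr) : R :=
  match e with
  | Jet j => env j
  | Inv2 => / env 2%nat
  | Opp e => - eval env e
  | Add e1 e2 => eval env e1 + eval env e2
  | Mul e1 e2 => eval env e1 * eval env e2
  end.

Fixpoint total_derivative (e : jet_expr) : jet_expr :=
  match e with
  | Jet j => Jet (S j)
  | Inv2 => Opp (Mul (Jet 3) (Mul Inv2 Inv2))
  | Opp e => Opp (total_derivative e)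
  | Add e1 e2 => Add (total_derivative e1) (total_derivative e2)
  | Mul e1 e2 =>
      Add (Mul (total_derivative e1) e2) (Mul e1 (total_derivative e2))
  end.

(** Besides bounding the order of the derivatives involved, this excludes
    [Jet 0]: the expressions may depend on [f', ..., f^(k)] but not on the value
    of [f]. *)
Fixpoint has_order (k : nat) (e : jet_expr) : Prop :=
  match e with
  | Jet j => (1 <= j <= k)%nat
  | Inv2 => (2 <= k)%nat
  | Opp e => has_order k e
  | Add e1 e2 | Mul e1 e2 => has_order k e1 /\ has_order k e2
  end.

Lemma has_order_S (k : nat) (e : jet_expr) : has_order k e -> has_order (S k) e.
Proof. induction e; simpl; intuition lia. Qed.

Lemma has_order_total_derivative (k : nat) (e : jet_expr) :
  has_order k e -> has_order (S k) (total_derivative e).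
Proof. induction e; simpl; intuition (auto using has_order_S; lia). Qed.

Lemma eval_ext (k : nat) (env1 env2 : nat -> R) (e : jet_expr) :
  (forall j, (1 <= j <= k)%nat -> env1 j = env2 j) ->
  has_order k e -> eval env1 e = eval env2 e.
Proof.
  intros Henv. induction e; simpl; intros He.
  - auto.
  - rewrite Henv by lia; reflexivity.
  - rewrite IHe; auto.
  - rewrite IHe1, IHe2; tauto.
  - rewrite IHe1, IHe2; tauto.
Qed.

Definition jet (f : R -> R) (x : R) (j : nat) : R := Derive_n f j x.

(** Formal differentiation computes the actual derivative of the expression along
    the jets of [f]. *)
Lemma is_derive_eval_jet (f : R -> R) (x : R) (k : nat) (e : jet_expr) :
  (forall j, (j <= S k)%nat -> ex_derive_n f j x) -> Derive_n f 2 x <> 0 ->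
  has_order k e ->
  is_derive (fun y => eval (jet f y) e) x (eval (jet f x) (total_derivative e)).
Proof.
  intros Hf H2.
  assert (HD : forall j, (j <= k)%nat ->
            is_derive (Derive_n f j) x (Derive_n f (S j) x)).
  { intros j Hj. apply Derive_correct, (Hf (S j)); lia. }
  induction e; cbn [eval total_derivative has_order]; intros He.
  - apply HD; lia.
  - unfold jet.
    replace (- (Derive_n f 3 x * (/ Derive_n f 2 x * / Derive_n f 2 x)))
      with (- Derive_n f 3 x / Derive_n f 2 x ^ 2) by (field; exact H2).
    apply is_derive_inv; [apply HD; lia|exact H2].
  - now apply (@is_derive_opp R_AbsRing R_NormedModule), IHe.
  - apply (@is_derive_plus R_AbsRing R_NormedModule); tauto.
  - apply (@is_derive_mult R_AbsRing (fun y => eval (jet f y) e1)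
             (fun y => eval (jet f y) e2)); [tauto|tauto|].
    intros; apply Rmult_comm.
Qed.

(** The expression of [g^(i+2)(f'(x))]: starting from [g'' = 1 / f''], each further
    derivative of [g] is obtained by differentiating in [x] and dividing by
    [f'']. *)
Fixpoint legendre_iter (i : nat) : jet_expr :=
  match i with
  | O => Inv2
  | S i => Mul Inv2 (total_derivative (legendre_iter i))
  end.

Definition legendre_expr (k : nat) : jet_expr := legendre_iter (k - 2).

Lemma legendre_expr_S (k : nat) :
  (2 <= k)%nat ->
  legendre_expr (S k) = Mul Inv2 (total_derivative (legendre_expr k)).
Proof.
  intros Hk. unfold legendre_expr.
  now replace (S k - 2)%nat with (S (k - 2)) by lia.
Qed.

Lemma has_order_legendre_expr (k : nat) :
  (2 <= k)%nat -> has_order k (legendre_expr k).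
Proof.
  induction 1 as [|k Hk IH].
  - simpl; lia.
  - rewrite legendre_expr_S by exact Hk.
    split; [simpl; lia|now apply has_order_total_derivative].
Qed.

(** * Differentiability of finite order *)

Lemma n_times_differentiable_at_ex_derive_n (n k : nat) (f : R -> R) (x : R) :
  n_times_differentiable_at n f x -> (k <= n)%nat -> ex_derive_n f k x.
Proof.
  intros [Hloc Hn] Hk. destruct (Nat.eq_dec k n) as [->|]; [exact Hn|].
  apply (locally_singleton _ _ Hloc). lia.
Qed.

Lemma n_times_differentiable_at_le (n k : nat) (f : R -> R) (x : R) :
  n_times_differentiable_at n f x -> (k <= n)%nat ->
  n_times_differentiable_at k f x.
Proof.
  intros H Hk. split.
  - apply (filter_imp _ _ (fun y Hy j Hj => Hy j (Nat.lt_le_trans _ _ _ Hj Hk))), H.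
  - now apply (n_times_differentiable_at_ex_derive_n n).
Qed.

(** Passing from the point to its neighbours costs one order: near [x] only the
    derivatives of order at most [n] are known to exist. *)
Lemma n_times_differentiable_at_locally (n : nat) (f : R -> R) (x : R) :
  n_times_differentiable_at (S n) f x ->
  locally x (fun y => n_times_differentiable_at n f y).
Proof.
  intros [Hloc _]. apply locally_locally in Hloc.
  apply (filter_imp _ _ (fun y Hy => conj
    (filter_imp _ _ (fun z Hz j Hj => Hz j (Nat.lt_lt_succ_r _ _ Hj)) Hy)
    (locally_singleton _ _ Hy n (Nat.lt_succ_diag_r n))) Hloc).
Qed.

(** The assumption under which order [k] of the theorem is proved at a point; by
    [regular_at_locally] it spreads from a point to its neighbours at the cost of
    one order. *)
Definition regular_at (a b : Rbar) (f : R -> R) (k : nat) (x : R) : Prop :=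
  in_Rbar_interval a b x /\ n_times_differentiable_at k f x /\
  Derive_n f 2 x <> 0.

Lemma regular_at_locally (a b : Rbar) (f : R -> R) (k : nat) (x : R) :
  (2 <= k)%nat -> regular_at a b f (S k) x ->
  locally x (regular_at a b f k).
Proof.
  intros Hk (Hx & Hf & H2).
  apply filter_and; [|apply filter_and].
  - now apply in_Rbar_interval_locally.
  - now apply n_times_differentiable_at_locally.
  - assert (Hc : continuous (Derive_n f 2) x).
    { apply (@ex_derive_continuous R_AbsRing R_NormedModule).
      apply (n_times_differentiable_at_ex_derive_n _ 3 _ _ Hf); lia. }
    apply (Hc (fun v => v <> 0)). apply open_neq, H2.
Qed.

(** * Higher derivatives of the Legendre transform *)

Section LegendreDerivatives.

Variables (a b : Rbar) (f g : R -> R).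
Hypothesis f_diff : forall x, in_Rbar_interval a b x -> ex_derive f x.
Hypothesis f'_inj : forall x y,
  in_Rbar_interval a b x -> in_Rbar_interval a b y ->
  Derive f x = Derive f y -> x = y.
Hypothesis g_legendre : is_legendre a b f g.

(** The induction is over all regular points at once: to differentiate [g^(k)] at
    [f'(x)] its value is needed at [f'(y)] for all [y] near [x], and these are
    regular of order [k] when [x] is regular of order [k + 1]. *)
Lemma legendre_derivatives (k : nat) :
  (2 <= k)%nat -> forall x, regular_at a b f k x ->
  n_times_differentiable_at k g (Derive f x) /\
  Derive_n g k (Derive f x) = eval (jet f x) (legendre_expr k).
Proof.
  induction 1 as [|k Hk IH]; intros x Hreg.
  - destruct Hreg as (Hx & Hf & H2).
    assert (Hd : is_derive (Derive g) (Derive f x) (/ Derive_n f 2 x)).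
    { apply (is_derive_inverse_slope a b); auto.
      apply (n_times_differentiable_at_ex_derive_n 2 2 _ _ Hf); lia. }
    split; [split|].
    + apply (filter_imp _ _) with (2 := Derive_locally_onto a b f f_diff f'_inj x
        (fun _ => True) Hx (filter_forall _ (fun _ => I))).
      intros m (y & Hy & _ & <-) j Hj.
      destruct j as [|[|j]]; [exact I| |lia].
      exists y. now apply (is_derive_legendre a b f).
    + eexists; exact Hd.
    + exact (is_derive_unique _ _ _ Hd).
  (* Near [f'(x)], [g^(k) = G o g'] because [g'] inverts [f']; the chain rule
     applies to this composite. *)
  - pose proof (regular_at_locally a b f k x Hk Hreg) as Hnear.
    destruct Hreg as (Hx & Hf & H2).
    pose proof (Derive_locally_onto a b f f_diff f'_inj x _ Hx Hnear) as Hslope.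
    set (G := fun y => eval (jet f y) (legendre_expr k)).
    assert (HG : is_derive G x (eval (jet f x) (total_derivative (legendre_expr k)))).
    { apply (is_derive_eval_jet f x k); auto using has_order_legendre_expr.
      intros j. now apply n_times_differentiable_at_ex_derive_n. }
    assert (Hd : is_derive (Derive_n g k) (Derive f x)
                   (eval (jet f x) (legendre_expr (S k)))).
    { rewrite legendre_expr_S by exact Hk.
      apply (is_derive_ext_loc (fun m => G (Derive g m))).
      - revert Hslope. apply filter_imp. intros m (y & Hy & Hreg & <-).
        rewrite (Derive_legendre a b f g) by assumption.
        symmetry. now apply IH.
      - apply (is_derive_comp G (Derive g)).
        + now rewrite (Derive_legendre a b f g) by assumption.
        + apply (is_derive_inverse_slope a b); auto.
          apply (n_times_differentiable_at_ex_derive_n _ 2 _ _ Hf); lia. }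
    split; [split|].
    + revert Hslope. apply filter_imp. intros m (y & Hy & Hreg & <-) j Hj.
      apply (n_times_differentiable_at_ex_derive_n k); [now apply IH|lia].
    + eexists; exact Hd.
    + exact (is_derive_unique _ _ _ Hd).
Qed.

Lemma is_derive_legendre_along_slope (k : nat) (x : R) :
  (2 <= k)%nat -> regular_at a b f (S k) x ->
  is_derive (fun y => Derive_n g k (Derive f y)) x
    (eval (jet f x) (total_derivative (legendre_expr k))).
Proof.
  intros Hk Hreg.
  apply (is_derive_ext_loc (fun y => eval (jet f y) (legendre_expr k))).
  - generalize (regular_at_locally a b f k x Hk Hreg). apply filter_imp.
    intros y Hy. symmetry. now apply legendre_derivatives.
  - destruct Hreg as (Hx & Hf & H2).
    apply (is_derive_eval_jet f x k); auto using has_order_legendre_expr.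
    intros j. now apply n_times_differentiable_at_ex_derive_n.
Qed.

End LegendreDerivatives.

(* [Phi k] is the function expressing the k-th derivative of [g] at m0 through
   f'(x0), ..., f^(k)(x0); it is chosen before n, I, f, g and x0, since
   otherwise that clause would be void. *)
Theorem mainTheorem2 :
  exists Phi : nat -> list R -> R,
  forall (n : nat) (a b : Rbar) (f g : R -> R) (x0 : R),
    (2 <= n)%nat ->
    (forall x, in_Rbar_interval a b x -> ex_derive f x) ->
    (forall x y, in_Rbar_interval a b x -> in_Rbar_interval a b y ->
       Derive f x = Derive f y -> x = y) ->
    is_legendre a b f g ->
    in_Rbar_interval a b x0 ->
    n_times_differentiable_at n f x0 ->
    Derive_n f 2 x0 <> 0 ->
    let m0 := Derive f x0 in
    n_times_differentiable_at n g m0 /\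
    g m0 = x0 * Derive f x0 - f x0 /\
    Derive g m0 = x0 /\
    Derive_n g 2 m0 = 1 / Derive_n f 2 x0 /\
    (forall k : nat, (2 <= k <= n - 1)%nat ->
       ex_derive (fun x => Derive_n g k (Derive f x)) x0 /\
       Derive_n g (k + 1) m0 =
         1 / Derive_n f 2 x0 *
         Derive (fun x => Derive_n g k (Derive f x)) x0) /\
    (forall k : nat, (2 <= k <= n)%nat ->
       Derive_n g k m0 =
         Phi k (map (fun j => Derive_n f j x0) (List.seq 1 k))) /\
    ((3 <= n)%nat ->
       Derive_n g 3 m0 = - (Derive_n f 3 x0 / (Derive_n f 2 x0) ^ 3)) /\
    ((4 <= n)%nat ->
       Derive_n g 4 m0 =
         (3 * (Derive_n f 3 x0) ^ 2 - Derive_n f 2 x0 * Derive_n f 4 x0)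
         / (Derive_n f 2 x0) ^ 5) /\
    ((5 <= n)%nat ->
       Derive_n g 5 m0 =
         (10 * Derive_n f 2 x0 * Derive_n f 3 x0 * Derive_n f 4 x0
          - 15 * (Derive_n f 3 x0) ^ 3
          - (Derive_n f 2 x0) ^ 2 * Derive_n f 5 x0)
         / (Derive_n f 2 x0) ^ 7).
Proof.
  (* The list starts with the derivative of order 1, hence the shift. *)
  exists (fun k l => eval (fun j => nth (j - 1) l 0) (legendre_expr k)).
  intros n a b f g x0 Hn f_diff f'_inj g_legendre Hx0 Hf H2 m0.
  assert (Hreg : forall k, (k <= n)%nat -> regular_at a b f k x0).
  { intros k Hk. repeat split; try apply Hx0; try exact H2;
      now apply (n_times_differentiable_at_le n). }
  assert (Hg : forall k, (2 <= k <= n)%nat ->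
            n_times_differentiable_at k g m0 /\
            Derive_n g k m0 = eval (jet f x0) (legendre_expr k)).
  { intros k Hk. apply (legendre_derivatives a b); auto; [lia|apply Hreg; lia]. }
  split; [apply Hg; lia|].
  split; [now apply g_legendre|].
  split; [now apply (Derive_legendre a b)|].
  split; [rewrite (proj2 (Hg 2%nat ltac:(lia))); simpl; unfold jet; now field|].
  split.
  { intros k Hk.
    assert (Hd := is_derive_legendre_along_slope a b f g f_diff f'_inj g_legendre
                    k x0 ltac:(lia) (Hreg (S k) ltac:(lia))).
    split; [eexists; exact Hd|].
    apply is_derive_unique in Hd.
    etransitivity; [|exact (f_equal (Rmult (1 / Derive_n f 2 x0)) (eq_sym Hd))].
    rewrite Nat.add_1_r,
      (proj2 (Hg (S k) ltac:(lia))), legendre_expr_S by lia.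
    simpl. unfold jet. now field. }
  split.
  { intros k Hk. rewrite (proj2 (Hg k Hk)).
    apply (eval_ext k); [|apply has_order_legendre_expr; lia].
    intros j Hj. unfold jet.
    rewrite (nth_indep _ 0 (Derive_n f 0 x0))
      by (rewrite length_map, length_seq; lia).
    rewrite (map_nth (fun j => Derive_n f j x0)), seq_nth by lia.
    now replace (1 + (j - 1))%nat with j by lia. }
  repeat split; intros Hk;
    match goal with |- Derive_n g ?k _ = _ =>
      rewrite (proj2 (Hg k ltac:(lia))) end;
    cbn [legendre_expr legendre_iter Nat.sub total_derivative eval];
    unfold jet; now field.
Qed.
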